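(* Let $\mathcal{V}=\{1,\dots,N\}$ and let $\{A(t)\}_{t\ge 0}$ ($t$ a non-negative integer) be a chain of $N\times N$ stochastic matrices in Class $\mathcal{P}^*$. Then $\{A(t)\}$ is ergodic if and only if it has the infinite jet-flow property.
   Context: Time $t$ is discrete, $t=0,1,2,\dots$. A stochastic matrix is a row-stochastic matrix (non-negative entries, each row sums to $1$); $A(t)=[a_{ij}(t)]$. Ergodic: for every $t_0\ge0$ the product $A(t)A(t-1)\cdots A(t_0)$ converges, as $t\to\infty$, to a matrix with identical rows. Absolute probability sequence: a sequence $\{\pi(t)\}_{t\ge0}$ of probability vectors in $\mathbb{R}^N$ with $\pi'(t+1)A(t)=\pi'(t)$ for all $t\ge0$ (prime is transpose). The chain is in Class $\mathcal{P}^*$ if it admits an absolute probability sequence for which there is $p^*>0$ with $\pi_i(t)\ge p^*$ for all $i\in\mathcal{V}$, $t\ge0$. Jets: a jet $J$ in $\mathcal{V}$ is a sequence $\{J(t)\}_{t\ge0}$ of subsets of $\mathcal{V}$; it is proper if $\emptyset\ne J(t)\subsetneq\mathcal{V}$ for all $t\ge0$. $\mathcal{V}\backslash J$ denotes the jet $\{\mathcal{V}\backslash J(t)\}$. For two disjoint jets $J^s,J^k$ (disjoint at each time), $$U(J^s,J^k)=\sum_{t=0}^\infty\Big[\sum_{i\in J^s(t+1)}\sum_{j\in J^k(t)}a_{ij}(t)+\sum_{i\in J^k(t+1)}\sum_{j\in J^s(t)}a_{ij}(t)\Big]\in[0,\infty].$$ The chain has the infinite jet-flow property if $U(J,\mathcal{V}\backslash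 J)=\infty$ for every proper jet $J$ in $\mathcal{V}$. *)

(* Defs.v *)
From mathcomp Require Import all_boot all_order all_algebra.
From mathcomp Require Import boolp classical_sets reals ereal topology.
From mathcomp Require Import normedtype sequences.

Set Implicit Arguments.
Unset Strict Implicit.
Unset Printing Implicit Defensive.

Import Order.TTheory GRing.Theory Num.Theory.
Import numFieldNormedType.Exports.

Local Open Scope classical_set_scope.
Local Open Scope ring_scope.

(* A chain is a sequence A : nat -> 'M[R]_N; the node set V = {1, ..., N} is
   represented by 'I_N. *)

Definition stochastic (R : realType) (N : nat) (M : 'M[R]_N) : Prop :=
  (forall i j, 0 <= M i j) /\ (forall i, \sum_j M i j = 1).

Definition prob_vector (R : realType) (N : nat) (p : 'cV[R]_N) : Prop :=
  (forall i, 0 <= p i 0) /\ \sum_i p i 0 = 1.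

(* A(t) A(t-1) ... A(t0), with the later matrices on the left; it is the
   identity when t < t0. *)
Definition backward_prod (R : realType) (N : nat) (A : nat -> 'M[R]_N)
    (t0 t : nat) : 'M[R]_N :=
  \big[mulmx/1%:M]_(k <- rev (index_iota t0 t.+1)) A k.

Definition ergodic (R : realType) (N : nat) (A : nat -> 'M[R]_N) : Prop :=
  forall t0 : nat, exists L : 'M[R]_N,
    (forall i j, row i L = row j L) /\
    (backward_prod A t0 t @[t --> \oo] --> L).

Definition absolute_prob_seq (R : realType) (N : nat) (A : nat -> 'M[R]_N)
    (p : nat -> 'cV[R]_N) : Prop :=
  (forall t, prob_vector (p t)) /\
  (forall t, (p t.+1)^T *m A t = (p t)^T).

Definition class_Pstar (R : realType) (N : nat) (A : nat -> 'M[R]_N) : Prop :=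
  exists p : nat -> 'cV[R]_N, absolute_prob_seq A p /\
    exists pstar : R, 0 < pstar /\ forall i t, pstar <= p t i 0.

Definition jet (N : nat) : Type := nat -> {set 'I_N}.

Definition proper_jet (N : nat) (J : jet N) : Prop :=
  forall t, J t != finset.set0 /\ J t \proper finset.setT.

Definition jet_compl (N : nat) (J : jet N) : jet N := fun t => ~: J t.

(* Meaningful as a flow between the two jets when they are disjoint at each
   time; the series is taken in the extended reals. *)
Definition jet_flow (R : realType) (N : nat) (A : nat -> 'M[R]_N)
    (Js Jk : jet N) : \bar R :=
  (\sum_(0 <= t <oo)
    (\sum_(i in Js t.+1) \sum_(j in Jk t) A t i j
     + \sum_(i in Jk t.+1) \sum_(j in Js t) A t i j)%R%:E)%E.

Definition infinite_jet_flow (R : realType) (N : nat) (A : nat -> 'M[R]_N)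
    : Prop :=
  forall J : jet N, proper_jet J -> jet_flow A J (jet_compl J) = +oo%E.

(* Main.v *)
Require Import Defs.
From mathcomp Require Import all_boot all_order all_algebra.
From mathcomp Require Import boolp classical_sets reals ereal topology.
From mathcomp Require Import normedtype sequences.
From mathcomp Require Import lra.

Set Implicit Arguments.
Unset Strict Implicit.
Unset Printing Implicit Defensive.

Import Order.TTheory GRing.Theory Num.Theory.
Import numFieldNormedType.Exports.

Local Open Scope ring_scope.

(** Write f_t for the flow at time t between a jet J and its complement: the
    total weight of the entries A(t)_ij such that exactly one of i in J(t+1)
    and j in J(t) holds ([cut]).

    Ergodicity implies infinite jet-flow.  If the flow of a proper jet J is
    finite, its tail after some T is less than 1/4.  Let x(T) be the indicator
    of J(T) and x(t+1) = A(t) x(t).  The sup distance from x(t) to the indicator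
    of J(t) grows by at most f_t at each step ([indicator_drift]), so x(t) stays
    above 3/4 on J(t) and below 1/4 off J(t); as both sets are nonempty, the
    rows of A(t)...A(T) cannot approach a common row.

    Infinite jet-flow implies ergodicity.  Let p be an absolute probability
    sequence bounded below by pstar > 0, and let x(t+1) = A(t) x(t) for
    t >= t0, where x_i(t) is thought of as the position of agent i.  The mean mu = sum_i p_i(t) x_i(t) does not depend on t
    ([mean_const]), and it suffices to show that every x_i(t) is eventually at
    most mu + eps ([eventually_le_mean]): applied to x and to -x, this gives
    convergence of every x_i to mu.  If it fails, then at every time t >= t0
    some agent is above mu + eps, while some agent is always at most mu.
    By Jensen's inequality the potentials
      Phi_c(t) = sum_i p_i(t) |x_i(t) - c|
    are nonincreasing and nonnegative, hence they are almost constant after some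
    time T, simultaneously for N + 1 centers c in ]mu, mu + eps[ spaced 2h
    apart.  At time T the N agents leave the open h-neighbourhood of one of
    these centers free.  The weighted sum of the tents (h - |x_i(t) - c|)^+ is the half second
    difference of Phi in c, so it vanishes at time T and remains small
    afterwards; since p_i(t) >= pstar, no agent ever comes back within h/2 of c
    ([free_threshold]).  From then on, the jet J(t) = {i | x_i(t) > c} is proper
    and each transition between J and its complement jumps over a gap around c,
    which costs potential: Phi_c(t) - Phi_c(t+1) >= pstar * h * f_t
    ([potential_drop_cut]).  Telescoping, the flow of J is finite
    ([threshold_flow_neqy]), a contradiction. *)

(** * Cuts and potentials for one stochastic matrix *)

Section Cut.
Variables (R : realType) (N : nat).
Implicit Types (M : 'M[R]_N) (S : {set 'I_N}) (p x : 'cV[R]_N).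

(** The flow through one step, from a node set [S] at time t to a node set [S']
    at time t+1: the entries of [M] whose row and column disagree on
    membership in [S'] and [S] respectively. *)
Definition cut M S S' : R :=
  \sum_i \sum_j M i j * ((i \in S') != (j \in S))%:R.

Lemma cutE M S S' :
  \sum_(i in S') \sum_(j in ~: S) M i j + \sum_(i in ~: S') \sum_(j in S) M i j
  = cut M S S'.
Proof.
rewrite /cut [RHS](bigID (mem S')) /=; congr (_ + _).
  apply: eq_bigr => i ->; rewrite [LHS]big_mkcond; apply: eq_bigr => j _.
  by rewrite inE; case: (j \in S); rewrite ?mulr0 ?mulr1.
apply: eq_big => [i|i]; rewrite inE // => /negbTE ->.
rewrite [LHS]big_mkcond; apply: eq_bigr => j _.
by case: (j \in S); rewrite ?mulr0 ?mulr1.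
Qed.

Lemma cut_ge0 M S S' : stochastic M -> 0 <= cut M S S'.
Proof.
by move=> [M0 _]; do 2 ![apply: sumr_ge0 => ? _]; rewrite mulr_ge0 ?ler0n.
Qed.

Lemma stochastic_dev M x c i :
  stochastic M -> (M *m x) i 0 - c = \sum_j M i j * (x j 0 - c).
Proof.
move=> [_ M1]; rewrite mxE -[X in _ - X]mul1r -(M1 i) mulr_suml -sumrB.
by apply: eq_bigr => j _; rewrite mulrBr.
Qed.

Lemma stochastic_avg_le M x c i :
  stochastic M -> (forall j, x j 0 <= c) -> (M *m x) i 0 <= c.
Proof.
move=> Ms xc; rewrite -subr_le0 stochastic_dev // sumr_le0 // => j _.
by rewrite mulr_ge0_le0 ?subr_le0 //; case: Ms.
Qed.

(** If [p'] is pulled back to [p] by [M], averaging against [p'] after applying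
    [M] is averaging against [p]. *)
Lemma weighted_push M p p' (f : 'I_N -> R) :
  p'^T *m M = p^T ->
  \sum_i p' i 0 * (\sum_j M i j * f j) = \sum_j p j 0 * f j.
Proof.
move=> pM; under eq_bigr do rewrite mulr_sumr.
rewrite exchange_big /=; apply: eq_bigr => j _.
have -> : p j 0 = (p^T) 0 j by rewrite mxE.
rewrite -pM mxE mulr_suml; apply: eq_bigr => i _.
by rewrite mxE mulrA.
Qed.

(** The [p]-weighted mean distance from the entries of [x] to [c]. *)
Definition potential p x (c : R) : R := \sum_i p i 0 * `|x i 0 - c|.

Lemma potential_ge0 p x c : (forall i, 0 <= p i 0) -> 0 <= potential p x c.
Proof. by move=> p0; apply: sumr_ge0 => i _; rewrite mulr_ge0. Qed.

(** Quantitative Jensen inequality: when the entries of [x] avoid the open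
    interval of radius [h] around [c], the potential drops by an amount
    proportional to the weight of the transitions that jump across [c].
    With [h = 0] it is plain monotonicity. *)
Lemma potential_drop_cut M p p' x (S S' : {set 'I_N}) (pstar c h : R) :
  stochastic M -> p'^T *m M = p^T -> 0 <= pstar ->
  (forall i, pstar <= p' i 0) -> 0 <= h ->
  (forall j, j \in S -> c + h <= x j 0) ->
  (forall j, j \notin S -> x j 0 <= c - h) ->
  (forall i, i \in S' -> c <= (M *m x) i 0) ->
  (forall i, i \notin S' -> (M *m x) i 0 <= c) ->
  potential p' (M *m x) c + pstar * (h *+ 2) * cut M S S' <= potential p x c.
Proof.
move=> Ms pM ps0 pps h0 xS xNS yS yNS.
rewrite /potential -(weighted_push _ pM) /cut mulr_sumr -big_split /=.
apply: ler_sum => i _.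
set F := \sum_j M i j * _.
have F0 : 0 <= F.
  by apply: sumr_ge0 => j _; rewrite mulr_ge0 ?ler0n //; case: Ms.
(* Up to the sign s of (M x)_i - c, the left-hand norm is the average of
   s (x_j - c); each j on the other side of c contributes 2 |x_j - c| >= 2h. *)
have key : `|(M *m x) i 0 - c| + h *+ 2 * F <= \sum_j M i j * `|x j 0 - c|.
  have [iS'|iNS'] := boolP (i \in S').
    rewrite ger0_norm ?subr_ge0 ?yS // stochastic_dev // mulr_sumr -big_split /=.
    apply: ler_sum => j _; rewrite mulrCA -mulrDr ler_wpM2l //; first by case: Ms.
    rewrite iS'; have [jS|jNS] := boolP (j \in S); first by rewrite mulr0 addr0 ler_norm.
    by have := xNS _ jNS => ?; rewrite ler0_norm /= ?mulr1; lra.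
  rewrite ler0_norm ?subr_le0 ?yNS // stochastic_dev // -sumrN mulr_sumr -big_split /=.
  apply: ler_sum => j _; rewrite mulrCA -mulrN -mulrDr ler_wpM2l //; first by case: Ms.
  rewrite (negbTE iNS'); have [jS|jNS] := boolP (j \in S).
    by have := xS _ jS => ?; rewrite ger0_norm /= ?mulr1; lra.
  by rewrite mulr0 addr0 -normrN ler_norm.
apply: le_trans (_ : p' i 0 * (`|(M *m x) i 0 - c| + h *+ 2 * F) <= _).
  by rewrite [leRHS]mulrDr lerD2l -mulrA ler_wpM2r ?mulr_ge0 ?mulrn_wge0.
by rewrite ler_wpM2l // (le_trans ps0).
Qed.

Lemma potential_step M p p' x c :
  stochastic M -> p'^T *m M = p^T -> (forall i, 0 <= p' i 0) ->
  potential p' (M *m x) c <= potential p x c.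
Proof.
move=> Ms pM p0.
have := @potential_drop_cut M p p' x [set j | c <= x j 0]%SET
  [set i | c <= (M *m x) i 0]%SET 0 c 0 Ms pM (lexx _) p0 (lexx _).
rewrite addr0 subr0 !mul0r addr0; apply=> i; rewrite inE //.
  by rewrite -ltNge => /ltW.
by rewrite -ltNge => /ltW.
Qed.

(** The second difference of the potential in [c] is the weighted sum of the
    tents |u - (c - h)| + |u - (c + h)| - 2 |u - c| = 2 (h - |u - c|)^+,
    for h >= 0. *)
Lemma potential_tent p x (c h : R) :
  (potential p x (c - h) + potential p x (c + h)) - potential p x c *+ 2 =
  \sum_i p i 0 * (`|x i 0 - (c - h)| + `|x i 0 - (c + h)| - `|x i 0 - c| *+ 2).
Proof.
rewrite /potential -big_split /= -sumrMnl -sumrB; apply: eq_bigr => i _.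
by rewrite mulrBr mulrDr mulrnAr.
Qed.

Lemma tent_eq0 (u c h : R) : 0 <= h -> h <= `|u - c| ->
  `|u - (c - h)| + `|u - (c + h)| - `|u - c| *+ 2 = 0.
Proof.
move=> h0; have [u0|u0] := lerP 0 (u - c).
  rewrite (ger0_norm u0) => hu.
  by rewrite !ger0_norm; lra.
rewrite (ltr0_norm u0) => hu.
by rewrite !ler0_norm; lra.
Qed.

Lemma tent_ge (u c h : R) : 0 <= h ->
  (h - `|u - c|) *+ 2 <= `|u - (c - h)| + `|u - (c + h)| - `|u - c| *+ 2.
Proof.
move=> h0; have := ler_norm (u - (c - h)); have := ler_norm (- (u - (c + h))).
by rewrite normrN; lra.
Qed.

Lemma tent_ge0 (u c h : R) :
  0 <= `|u - (c - h)| + `|u - (c + h)| - `|u - c| *+ 2.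
Proof.
have := ler_normD (u - (c - h)) (u - (c + h)).
have -> : u - (c - h) + (u - (c + h)) = (u - c) *+ 2 by lra.
by rewrite normrMn; lra.
Qed.

End Cut.

(** * Monotone sequences and series of nonnegative reals *)

Section RealSequences.
Variable R : realType.
Implicit Types u f : nat -> R.

Lemma nonincreasing_lb_tail u t0 (b e : R) :
  (forall t, (t0 <= t)%N -> u t.+1 <= u t) ->
  (forall t, (t0 <= t)%N -> b <= u t) -> 0 < e ->
  exists2 T, (t0 <= T)%N & forall t, (T <= t)%N -> u T - u t < e.
Proof.
move=> du bu e0.
pose E := [set y | exists2 t, (t0 <= t)%N & y = u t]%classic.
have Ei : has_inf E.
  split; first by exists (u t0), t0.
  by exists b => _ [t t0t ->]; exact: bu.
have [_ [T t0T ->] uT] := inf_adherent e0 Ei.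
exists T => // t Tt; rewrite ltrBlDl (lt_le_trans uT) // lerD2r.
by apply: (ge_inf (proj2 Ei)); exists t; rewrite // (leq_trans t0T).
Qed.

Lemma nonincreasing_from u t0 :
  (forall t, (t0 <= t)%N -> u t.+1 <= u t) ->
  forall s t, (t0 <= s)%N -> (s <= t)%N -> u t <= u s.
Proof.
move=> du s t t0s /subnK <-; elim: (t - s)%N => [//|k ih].
by rewrite addSn (le_trans _ ih) // du // (leq_trans t0s) ?leq_addl.
Qed.

(** A convergent series of nonnegative reals has small tails, stated on finite
    partial sums. *)
Lemma nneseries_neqy_tail f (e : R) :
  (forall t, 0 <= f t) -> (\sum_(0 <= t <oo) (f t)%:E)%E <> +oo%E -> 0 < e ->
  exists T, forall t, (T <= t)%N -> \sum_(T <= s < t) f s < e.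
Proof.
move=> f0 foo e0.
have fin : (\sum_(0 <= t <oo) (f t)%:E)%E \is a fin_num.
  rewrite fin_numE; apply/andP; split; last exact/eqP.
  rewrite gt_eqF // (lt_le_trans ltNy0) // nneseries_ge0 // => *.
  by rewrite lee_fin.
pose B := fine (\sum_(0 <= t <oo) (f t)%:E)%E.
have fB n : \sum_(0 <= t < n) f t <= B.
  rewrite -lee_fin -sumEFin fineK //; apply: nneseries_lim_ge => *.
  by rewrite lee_fin.
have [|t _|T _ HT] := @nonincreasing_lb_tail
    (fun n => - \sum_(0 <= t < n) f t) 0%N (- B) e _ _ e0.
- by move=> t _; rewrite lerN2 big_nat_recr //= lerDl.
- by rewrite lerN2.
exists T => t Tt; have := HT _ Tt.
rewrite opprK (big_cat_nat (n := T) (p := t)) //=; lra.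
Qed.

Lemma nneseries_bounded_neqy f (B : R) :
  (forall t, 0 <= f t) -> (forall n, \sum_(0 <= t < n) f t <= B) ->
  (\sum_(0 <= t <oo) (f t)%:E)%E <> +oo%E.
Proof.
move=> f0 fB foo.
have : (\sum_(0 <= t <oo) (f t)%:E <= B%:E)%E.
  apply: lime_le.
    by apply: is_cvg_nneseries => *; rewrite lee_fin.
  by apply: nearW => n; rewrite sumEFin lee_fin.
by rewrite foo leNgt ltry.
Qed.

End RealSequences.

(** * Ergodic chains have the infinite jet-flow property *)

Section Chain.
Variables (R : realType) (N : nat) (A : nat -> 'M[R]_N).
Hypothesis A_stochastic : forall t, stochastic (A t).

Lemma jet_flowE (J : jet N) :
  jet_flow A J (jet_compl J) =
  (\sum_(0 <= t <oo) (cut (A t) (J t) (J t.+1))%:E)%E.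
Proof. by apply: eq_eseriesr => t _; rewrite /jet_compl cutE. Qed.

(** The product A(t-1) ... A(t0), so that [backward_prod A t0 t] is
    [prod_to t0 t.+1]; it is the identity at [t = t0]. *)
Definition prod_to (t0 t : nat) : 'M[R]_N :=
  \big[mulmx/1%:M]_(k <- rev (index_iota t0 t)) A k.

Lemma prod_to_id t0 : prod_to t0 t0 = 1%:M.
Proof. by rewrite /prod_to /index_iota subnn big_nil. Qed.

Lemma prod_toS t0 t : (t0 <= t)%N -> prod_to t0 t.+1 = A t *m prod_to t0 t.
Proof.
move=> t0t; rewrite /prod_to /index_iota subSn // -addn1 iotaD rev_cat /=.
by rewrite big_cons subnKC.
Qed.

(** A trajectory started at the indicator of [J T] departs from the indicator of
    [J t], in sup norm, by at most the flow of [J] between [T] and [t]. *)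
Lemma indicator_drift (J : jet N) (x : nat -> 'cV[R]_N) T :
  (forall t, (T <= t)%N -> x t.+1 = A t *m x t) ->
  (forall i, x T i 0 = (i \in J T)%:R) ->
  forall t i, (T <= t)%N ->
  `|x t i 0 - (i \in J t)%:R| <= \sum_(T <= s < t) cut (A s) (J s) (J s.+1).
Proof.
move=> xS xT t i /subnK <-; elim: (t - T)%N i => [|k ih] i.
  by rewrite add0n xT subrr normr0 big_geq.
rewrite addSn; set s := (k + T)%N in ih *.
have Ts : (T <= s)%N by exact: leq_addl.
have [A0 A1] := A_stochastic s.
rewrite xS // stochastic_dev // big_nat_recr //=.
set D := \sum_(T <= _ < _) _ in ih *.
apply: le_trans (ler_norm_sum _ _ _) _.
apply: le_trans (_ : \sum_j A s i j * (D + ((i \in J s.+1) != (j \in J s))%:R) <= _).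
  apply: ler_sum => j _; rewrite normrM ger0_norm // ler_wpM2l //.
  apply: le_trans (ler_distD (j \in J s)%:R _ _) _; rewrite lerD //.
  by case: (_ \in _); case: (_ \in _); rewrite ?subrr ?subr0 ?sub0r ?normrN ?normr1 ?normr0.
under eq_bigr do rewrite mulrDr.
rewrite big_split /= -mulr_suml A1 mul1r lerD2l /cut [leRHS](bigD1 i) //= lerDl.
by do 2 ![apply: sumr_ge0 => ? _]; rewrite mulr_ge0 ?ler0n.
Qed.

Lemma ergodic_infinite_jet_flow : ergodic A -> infinite_jet_flow A.
Proof.
move=> erg J Jp; apply: contrapT; rewrite jet_flowE => fin.
have cut0 t : 0 <= cut (A t) (J t) (J t.+1) by exact: cut_ge0.
have q0 : 0 < 4^-1 :> R by rewrite invr_gt0.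
have [T HT] := nneseries_neqy_tail cut0 fin q0.
have [L [Lrow LA]] := erg T.
pose b : 'cV[R]_N := \col_i (i \in J T)%:R.
pose x t := prod_to T t *m b.
have xS t : (T <= t)%N -> x t.+1 = A t *m x t.
  by move=> Tt; rewrite /x prod_toS // mulmxA.
have xT i : x T i 0 = (i \in J T)%:R by rewrite /x prod_to_id mul1mx mxE.
have drift := indicator_drift xS xT.
(* Entries of the product within e of their limit put any two entries of x
   within 2 N e < 1/2 of each other. *)
pose e : R := (N.+1%:R * 4)^-1.
have e0 : 0 < e by rewrite invr_gt0 mulr_gt0 ?ltr0n.
have [n _ Hn] := cvg_ball LA e0.
pose t := maxn T n.
have [_ near] := Hn t (leq_maxr T n).
have TS : (T <= t.+1)%N by rewrite leqW // leq_maxl.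
have [/finset.set0Pn [i iJ] /properP [_ [j _ jJ]]] := Jp t.+1.
have xi := le_lt_trans (drift _ i TS) (HT _ TS).
have xj := le_lt_trans (drift _ j TS) (HT _ TS).
rewrite iJ /= in xi; rewrite (negbTE jJ) /= in xj.
have Lij k : L i k = L j k by have /rowP/(_ k) := Lrow i j; rewrite !mxE.
have : x t.+1 i 0 - x t.+1 j 0 <= \sum_(k < N) e *+ 2.
  rewrite /x !mxE -sumrB; apply: ler_sum => k _.
  have := near i k; have := near j k; rewrite -Lij /ball /= => nj ni.
  rewrite -mulrBl [b _ _]mxE; case: (_ \in _); rewrite ?mulr1 ?mulr0; last first.
    by rewrite mulrn_wge0 // ltW.
  rewrite /backward_prod -/(prod_to T t.+1) in ni nj.
  by move: ni nj; rewrite !ltr_norml => /andP[? ?] /andP[? ?]; lra.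
rewrite sumr_const card_ord.
have : e *+ 2 *+ N <= 2^-1.
  rewrite -mulrnA -[X in X <= _]mulr_natr /e natrM.
  rewrite mulrC ler_pdivrMr ?mulr_gt0 ?ltr0n //.
  have : (N%:R <= N.+1%:R :> R) by rewrite ler_nat.
  lra.
move: xi xj; rewrite !ltr_norml => /andP[? ?] /andP[? ?]; lra.
Qed.

(** * Class P-star chains with infinite jet-flow are ergodic *)

Variables (p : nat -> 'cV[R]_N) (pstar : R).
Hypothesis p_abs : absolute_prob_seq A p.
Hypothesis pstar_gt0 : 0 < pstar.
Hypothesis pstar_le : forall i t, pstar <= p t i 0.

Let p_ge0 t i : 0 <= p t i 0.
Proof. exact: le_trans (ltW pstar_gt0) (pstar_le i t). Qed.

Section Trajectory.
Variables (x : nat -> 'cV[R]_N) (t0 : nat).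
Hypothesis x_step : forall t, (t0 <= t)%N -> x t.+1 = A t *m x t.

Lemma mean_const t : (t0 <= t)%N ->
  \sum_i p t i 0 * x t i 0 = \sum_i p t0 i 0 * x t0 i 0.
Proof.
move=> /subnK <-; elim: (t - t0)%N => [//|k <-].
rewrite addSn x_step ?leq_addl // -(weighted_push _ (proj2 p_abs (k + t0)%N)).
by apply: eq_bigr => i _; rewrite mxE.
Qed.

Lemma upper_bound_persists c s t : (t0 <= s)%N -> (s <= t)%N ->
  (forall i, x s i 0 <= c) -> forall i, x t i 0 <= c.
Proof.
move=> t0s /subnK <- xs; elim: (t - s)%N => [//|k ih] i.
rewrite addSn x_step; last by rewrite (leq_trans t0s) ?leq_addl.
exact: stochastic_avg_le.
Qed.

Lemma potential_nonincr c t : (t0 <= t)%N ->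
  potential (p t.+1) (x t.+1) c <= potential (p t) (x t) c.
Proof. by move=> t0t; rewrite x_step // potential_step //; case: p_abs. Qed.

(** Every interval ]mu, mu + eps[ contains a threshold from which, after some
    time, all agents remain at a distance bounded away from 0. *)
Lemma free_threshold (mu eps : R) : 0 < eps ->
  exists c h T, [/\ 0 < h, mu < c < mu + eps, (t0 <= T)%N
    & forall t i, (T <= t)%N -> h <= `|x t i 0 - c|].
Proof.
move=> eps0; pose K := N.+1.
have K0 : 0 < K%:R :> R by rewrite ltr0n.
have [h h0 hK] : exists2 h : R, 0 < h & h *+ 2 * K%:R = eps.
  exists (eps / (K%:R *+ 2)); first by rewrite divr_gt0 // mulrn_wgt0.
  by rewrite mulrnAl -mulrnAr divfK // gt_eqF // mulrn_wgt0.
pose c (k : 'I_K) := mu + h + h *+ 2 * k%:R.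
pose u t := \sum_k potential (p t) (x t) (c k).
have e0 : 0 < pstar * (h / 2) by rewrite mulr_gt0 ?divr_gt0 ?ltr0n.
have [|t _|T t0T HT] := @nonincreasing_lb_tail R u t0 0 _ _ _ e0.
- by move=> t t0t; apply: ler_sum => k _; exact: potential_nonincr.
- by apply: sumr_ge0 => k _; apply: potential_ge0 => i; exact: p_ge0.
(* The N + 1 open h-neighbourhoods are disjoint, so N agents cannot meet
   them all. *)
have [k kfree] : exists k, forall i, h <= `|x T i 0 - c k|.
  apply: contrapT => /forallNP nofree.
  have near k : exists i, `|x T i 0 - c k| < h.
    have /existsNP [i hi] := nofree k.
    by exists i; rewrite ltNge; apply/negP.
  have [f Hf] := choice near.
  have : injective f.
    move=> k l fkl; apply/val_inj => /=.
    have := Hf k; have := Hf l; rewrite -fkl !ltr_norml => /andP[l1 l2] /andP[k1 k2].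
    rewrite /c in l1 l2 k1 k2.
    have kl : (k%:R - l%:R < 1 :> R) by rewrite -(ltr_pM2l h0); lra.
    have lk : (l%:R - k%:R < 1 :> R) by rewrite -(ltr_pM2l h0); lra.
    move: kl lk; rewrite !ltrBlDr !(addrC 1) !natr1 !ltr_nat !ltnS => kl lk.
    by apply/eqP; rewrite eqn_leq kl lk.
  by move=> /leq_card; rewrite !card_ord ltnn.
exists (c k), (h / 2), T; split; rewrite ?divr_gt0 ?ltr0n //.
  have : k%:R + 1 <= K%:R :> R by rewrite natr1 ler_nat.
  rewrite -(ler_pM2l h0) => kK.
  have k0 : 0 <= h * k%:R by rewrite mulr_ge0 ?ler0n // ltW.
  by apply/andP; split; rewrite /c; lra.
move=> t i Tt.
have t0s s : (T <= s)%N -> (t0 <= s)%N by exact: leq_trans.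
have dec d : potential (p t) (x t) d <= potential (p T) (x T) d.
  by apply: (nonincreasing_from (fun s => @potential_nonincr d s)).
have drop : potential (p T) (x T) (c k) - potential (p t) (x t) (c k)
    < pstar * (h / 2).
  apply: le_lt_trans (HT _ Tt); rewrite /u -[leRHS]sumrB [leRHS](bigD1 k) //= lerDl.
  by apply: sumr_ge0 => l _; rewrite subr_ge0.
have tentT := potential_tent (p T) (x T) (c k) h.
rewrite big1 in tentT; last first.
  by move=> j _; rewrite (tent_eq0 (ltW h0)) ?mulr0.
have tentt := potential_tent (p t) (x t) (c k) h.
have [w wE] : exists w, w =
    `|x t i 0 - (c k - h)| + `|x t i 0 - (c k + h)| - `|x t i 0 - c k| *+ 2.
  by eexists.
have := tent_ge (x t i 0) (c k) (ltW h0).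
have := tent_ge0 (x t i 0) (c k) h.
rewrite -wE => w0 wge.
have : pstar * w <= pstar * (h / 2) *+ 2.
  apply: le_trans (_ : p t i 0 * w <= _); first by rewrite ler_wpM2r.
  have : p t i 0 * w <= \sum_i p t i 0 *
     (`|x t i 0 - (c k - h)| + `|x t i 0 - (c k + h)| - `|x t i 0 - c k| *+ 2).
    rewrite (bigD1 i) //= -wE lerDl; apply: sumr_ge0 => j _.
    by rewrite mulr_ge0 // tent_ge0.
  rewrite -tentt; have := dec (c k - h); have := dec (c k + h); lra.
rewrite -mulrnAr ler_pM2l //; lra.
Qed.

(** The agents above a threshold that no agent approaches after [T] form a jet of
    finite flow; before [T] the jet is frozen at its value at [T], which adds
    only finitely many terms. *)
Lemma threshold_flow_neqy (c h : R) T :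
  0 < h -> (t0 <= T)%N ->
  (forall t i, (T <= t)%N -> h <= `|x t i 0 - c|) ->
  let J : jet N := fun t => [set i | c < x (maxn t T) i 0]%SET in
  jet_flow A J (jet_compl J) <> +oo%E.
Proof.
move=> h0 t0T free J; rewrite jet_flowE.
set f := fun t => cut (A t) (J t) (J t.+1).
have f0 t : 0 <= f t by exact: cut_ge0.
pose C := pstar * (h *+ 2).
have C0 : 0 < C by rewrite mulr_gt0 ?mulrn_wgt0.
pose Phi t := potential (p t) (x t) c.
have drop t : (T <= t)%N -> Phi t.+1 + C * f t <= Phi t.
  move=> Tt; have t0t := leq_trans t0T Tt.
  have xJ s i : (T <= s)%N -> (i \in J s) = (c < x s i 0).
    by move=> Ts; rewrite inE (maxn_idPl Ts).
  rewrite /Phi x_step // /f; apply: potential_drop_cut; rewrite ?(ltW pstar_gt0) ?(ltW h0) //.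
  - by case: p_abs.
  - move=> j; rewrite xJ // => cx; have := free _ j Tt.
    by rewrite gtr0_norm ?subr_gt0 //; lra.
  - move=> j; rewrite xJ // -leNgt => cx; have := free _ j Tt.
    by rewrite ler0_norm ?subr_le0 //; lra.
  - by move=> i; rewrite xJ ?leqW // x_step // => /ltW.
  - by move=> i; rewrite xJ ?leqW // x_step // -leNgt.
(* Telescoping the drops of the potential. *)
have tail n : (T <= n)%N -> C * (\sum_(T <= t < n) f t) <= Phi T - Phi n.
  move=> /subnK <-; elim: (n - T)%N => [|k ih].
    by rewrite big_geq // mulr0 subrr.
  rewrite addSn big_nat_recr ?leq_addl //= mulrDr.
  by have := drop (k + T)%N (leq_addl _ _); lra.
apply: (@nneseries_bounded_neqy R f (\sum_(0 <= t < T) f t + C^-1 * Phi T)) => // n.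
have PhiT : 0 <= C^-1 * Phi T by rewrite mulr_ge0 ?potential_ge0 // invr_ge0 ltW.
have [nT|Tn] := leqP n T.
  rewrite (big_cat_nat (n := n) (p := T)) //= -addrA lerDl.
  by rewrite addr_ge0 // sumr_ge0.
rewrite (big_cat_nat (n := T)) ?(ltnW Tn) //= lerD2l.
rewrite -(ler_pM2l C0) mulVKf ?gt_eqF // (le_trans (tail _ (ltnW Tn))) //.
by rewrite gerBl potential_ge0.
Qed.

(** Otherwise some agent would exceed the mean by [eps] at all times, and a free
    threshold in between would cut out a proper jet of finite flow. *)
Lemma eventually_le_mean : infinite_jet_flow A ->
  forall eps, 0 < eps -> exists T, forall t i, (T <= t)%N ->
    x t i 0 <= \sum_i p t0 i 0 * x t0 i 0 + eps.
Proof.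
move=> Aflow eps eps0; set mu := \sum_i _.
have [//|noT] := pselect (exists T, forall t i, (T <= t)%N -> x t i 0 <= mu + eps).
exfalso.
have above t : (t0 <= t)%N -> exists i, mu + eps < x t i 0.
  move=> t0t; apply: contrapT => /forallNP noi; apply: noT; exists t => s i ts.
  apply: (@upper_bound_persists _ t) => // j.
  by rewrite leNgt; apply/negP/noi.
have below t : (t0 <= t)%N -> exists i, x t i 0 <= mu.
  move=> t0t; apply: contrapT => /forallNP noi.
  have [_ p1] := proj1 p_abs t.
  have [i0 _] := above t t0t.
  have : \sum_i p t i 0 * mu < \sum_i p t i 0 * x t i 0.
    apply: ltr_sum; first by apply/hasP; exists i0; rewrite ?mem_index_enum.
    move=> i _; rewrite ltr_pM2l; last exact: lt_le_trans (pstar_le i t).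
    by rewrite ltNge; apply/negP/noi.
  by rewrite mean_const // -mulr_suml p1 mul1r ltxx.
have [c [h [T [h0 /andP[muc ceps] t0T free]]]] := free_threshold mu eps0.
apply: (threshold_flow_neqy h0 t0T free); apply: Aflow => t.
have t0m : (t0 <= maxn t T)%N by rewrite (leq_trans t0T) ?leq_maxr.
split; first apply/finset.set0Pn.
  have [i xi] := above _ t0m; exists i.
  by rewrite inE (lt_trans ceps).
apply/properP; split; first exact: finset.subsetT.
have [i xi] := below _ t0m; exists i; rewrite ?inE //.
by rewrite -leNgt (le_trans xi) // ltW.
Qed.

End Trajectory.

Lemma infinite_jet_flow_ergodic : infinite_jet_flow A -> ergodic A.
Proof.
move=> Aflow t0.
(* Column j of the product starts at the j-th basis vector, whose mean
   is p_j(t0). *)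
pose L : 'M[R]_N := \matrix_(i, j) p t0 j 0.
exists L; split; first by move=> i j; apply/rowP => k; rewrite !mxE.
apply/cvg_ballP => e e0.
have e20 : 0 < e / 2 by rewrite divr_gt0 ?ltr0n.
pose x (j : 'I_N) t := col j (prod_to t0 t).
have xS j t : (t0 <= t)%N -> x j t.+1 = A t *m x j t.
  by move=> t0t; rewrite /x prod_toS // !colE mulmxA.
have nxS j t : (t0 <= t)%N -> - x j t.+1 = A t *m - x j t.
  by move=> t0t; rewrite xS // mulmxN.
have mu j : \sum_i p t0 i 0 * x j t0 i 0 = p t0 j 0.
  rewrite (bigD1 j) //= /x prod_to_id !mxE eqxx mulr1 big1 ?addr0 // => i ij.
  by rewrite !mxE (negbTE ij) mulr0.
have nmu j : \sum_i p t0 i 0 * (- x j t0) i 0 = - p t0 j 0.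
  by rewrite -mu -sumrN; apply: eq_bigr => i _; rewrite mxE mulrN.
have [Tu HTu] := choice (fun j => eventually_le_mean (xS j) Aflow e20).
have [Tl HTl] := choice (fun j => eventually_le_mean (nxS j) Aflow e20).
pose T := (\max_j maxn (Tu j) (Tl j))%N.
exists T => // t /= Tt; split=> // i j.
have Tj : (maxn (Tu j) (Tl j) <= t.+1)%N.
  by rewrite leqW // (leq_trans _ Tt) // leq_bigmax.
have := HTu j t.+1 i (leq_trans (leq_maxl _ _) Tj).
have := HTl j t.+1 i (leq_trans (leq_maxr _ _) Tj).
rewrite mu nmu !mxE /ball /= /backward_prod -/(prod_to t0 t.+1) ltr_norml => ? ?.
by apply/andP; split; lra.
Qed.

End Chain.

Theorem corollary2 (R : realType) (N : nat) (A : nat -> 'M[R]_N)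
    (A_stochastic : forall t : nat, stochastic (A t))
    (A_Pstar : class_Pstar A) :
  ergodic A <-> infinite_jet_flow A.
Proof.
split; first exact: ergodic_infinite_jet_flow.
have [p [p_abs [pstar [pstar_gt0 pstar_le]]]] := A_Pstar.
exact: infinite_jet_flow_ergodic p_abs pstar_gt0 pstar_le.
Qed.
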